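(* Let $\mathcal{A}$ be a non-unital Banach algebra and let $\mathcal{A}^{\#}$ be its unitization. Then $\mathcal{A}$ is approximately cyclic amenable if and only if $\mathcal{A}^{\#}$ is approximately cyclic amenable.
   Context: $\mathcal{A}^{\#}=\mathbb{C}e\oplus\mathcal{A}$ is the unitization of $\mathcal{A}$, with adjoined identity $e$. For a Banach algebra $\mathcal{C}$, the dual $\mathcal{C}^*$ is a Banach $\mathcal{C}$-bimodule via $\langle x, a\cdot\Lambda\rangle=\langle xa,\Lambda\rangle$ and $\langle x,\Lambda\cdot a\rangle=\langle ax,\Lambda\rangle$. A derivation $D:\mathcal{C}\to\mathcal{C}^*$ is a linear map with $D(ab)=a\cdot D(b)+D(a)\cdot b$. It is cyclic if $\langle Da,b\rangle+\langle a,Db\rangle=0$ for all $a,b\in\mathcal{C}$. It is approximately inner if there is a net $(\Lambda_\alpha)\subseteq\mathcal{C}^*$ (not required to be bounded) with $D(a)=\lim_\alpha(a\cdot\Lambda_\alpha-\Lambda_\alpha\cdot a)$ in norm for every $a\in\mathcal{C}$. $\mathcal{C}$ is approximately cyclic amenable if every cyclic derivation $\mathcal{C}\to\mathcal{C}^*$ is approximately inner. *)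

(* Defs.v *)
From HB Require Import structures.
From mathcomp Require Import all_boot all_order all_algebra.
From mathcomp Require Import complex.
From mathcomp Require Import all_classical all_reals all_analysis.

Set Implicit Arguments.
Unset Strict Implicit.
Unset Printing Implicit Defensive.

Import Order.TTheory GRing.Theory Num.Theory.
Import ComplexField.Normc.
Import numFieldNormedType.Exports.

Local Open Scope classical_set_scope.
Local Open Scope ring_scope.
Local Open Scope complex_scope.

(* The algebra need not have an identity, so the product is a field of its own
   rather than the multiplication of a MathComp ring. *)
HB.mixin Record NormedModule_isBanachAlgebra (R : realType) A
    & CompleteNormedModule R[i] A := {
  bmul : A -> A -> A;
  bmulA : associative bmul;
  bmulDl : left_distributive bmul +%R;
  bmulDr : right_distributive bmul +%R;
  bmulZl : forall (c : R[i]) (a b : A), bmul (c *: a) b = c *: bmul a b;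
  bmulZr : forall (c : R[i]) (a b : A), bmul a (c *: b) = c *: bmul a b;
  ler_normbM : forall a b : A, `|bmul a b| <= `|a| * `|b|
}.

#[short(type="banachAlgType")]
HB.structure Definition BanachAlgebra (R : realType) :=
  {A of CompleteNormedModule R[i] A & NormedModule_isBanachAlgebra R A}.

Declare Scope banach_scope.
Delimit Scope banach_scope with BA.
Local Open Scope banach_scope.
Notation "a ** b" := (bmul a b)
  (at level 40, left associativity) : banach_scope.

Definition unital (R : realType) (A : banachAlgType R) : Prop :=
  exists e : A, forall a : A, e ** a = a /\ a ** e = a.

Section ComplexComplete.
Variable R : realType.

Lemma normc_le_ReIm (z : R[i]) :
  `|z| <= (`|complex.Re z| + `|complex.Im z|)%:C.
Proof.
rewrite normc_def lecR -ler_sqr ?nnegrE ?sqrtr_ge0 ?addr_ge0//.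
rewrite sqr_sqrtr ?addr_ge0 ?sqr_ge0// sqrrD !real_normK ?num_real//.
by rewrite lerD2r lerDl mulrn_wge0// mulr_ge0.
Qed.

Lemma normc_ge_Im (z : R[i]) : `|complex.Im z|%:C <= `|z|.
Proof.
by rewrite normc_def lecR -sqrtr_sqr ler_wsqrtr// lerDr sqr_ge0.
Qed.

Lemma complex_complete (F : set_system R[i]^o) :
  ProperFilter F -> cauchy F -> cvg F.
Proof.
move=> FF /cauchyP Fc.
have ReF : cvg (@complex.Re R @ F : set_system R).
  apply: cauchy_cvg; apply/cauchyP => e e0.
  have [|z Fz] := Fc e%:C; first by rewrite ltcR.
  exists (complex.Re z); rewrite /fmap/=; apply: filterS Fz => w.
  rewrite -!ball_normE /= -ltcR -raddfB; exact/le_lt_trans/normc_ge_Re.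
have ImF : cvg (@complex.Im R @ F : set_system R).
  apply: cauchy_cvg; apply/cauchyP => e e0.
  have [|z Fz] := Fc e%:C; first by rewrite ltcR.
  exists (complex.Im z); rewrite /fmap/=; apply: filterS Fz => w.
  rewrite -!ball_normE /= -ltcR -raddfB; exact/le_lt_trans/normc_ge_Im.
apply/cvg_ex.
exists (Complex (lim (@complex.Re R @ F)) (lim (@complex.Im R @ F))).
apply/cvgrPdist_lt => e.
rewrite ltcE/= => /andP[/eqP Ime e0].
have e20 : 0 < complex.Re e / 2 by rewrite divr_gt0.
have /cvgrPdist_lt/(_ _ e20) Fr := ReF.
have /cvgrPdist_lt/(_ _ e20) Fi := ImF.
apply: filterS2 Fr Fi => z zr zi.
apply: le_lt_trans (normc_le_ReIm _) _.
rewrite ltcE/= Ime eqxx/= [ltRHS]splitr; case: z zr zi => a b /= zr zi.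
exact: ltrD.
Qed.

End ComplexComplete.

Section Dual.
Variables (R : realType) (A : normedModType R[i]).

Definition continuous_functional : {pred A -> R[i]^o} :=
  mem [set f : A -> R[i]^o | linear f /\ continuous f].

(* The topological dual of A. *)
Record dual := Dual {
  dual_fun :> A -> R[i]^o;
  dualP : dual_fun \in continuous_functional
}.

HB.instance Definition _ := [isSub for dual_fun].
HB.instance Definition _ := [Choice of dual by <:].

Lemma continuous_functional_submod : submod_closed continuous_functional.
Proof.
split.
  apply/mem_set; split=> [c x y|]; last exact: cst_continuous.
  by rewrite /= scaler0 addr0.
move=> a f g /set_mem[lf cf] /set_mem[lg cg].
apply/mem_set; split=> [c x y|x].
  rewrite !fctE lf lg !scalerDr !addrA; congr (_ + _).
  by rewrite addrAC !scalerA mulrC addrAC.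
by apply: cvgD; [apply: cvgZ; [exact: cvg_cst|exact: cf]|exact: cg].
Qed.

HB.instance Definition _ := GRing.isSubmodClosed.Build _ _
  continuous_functional continuous_functional_submod.
HB.instance Definition _ := [SubChoice_isSubLmodule of dual by <:].

Lemma dual_linear (f : dual) : linear f.
Proof. by have /set_mem[] := dualP f. Qed.

HB.instance Definition _ (f : dual) :=
  GRing.isLinear.Build R[i] A R[i]^o _ f (dual_linear f).

Lemma dual_continuous (f : dual) : continuous f.
Proof. by have /set_mem[] := dualP f. Qed.

Lemma dual_bounded (f : dual) :
  exists2 M : R, 0 <= M & forall x, `|f x| <= M%:C * `|x|.
Proof.
have /linear_bounded_continuous/linear_boundedP := @dual_continuous f.
move=> /pinfty_ex_gt0[r r0 fr]; have rR := RRe_real (gtr0_real r0).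
by exists (complex.Re r); rewrite ?rR// -lecR rR ltW.
Qed.

Lemma bounded_functional (f : A -> R[i]^o) (M : R) :
  linear f -> (forall x, `|f x| <= M%:C * `|x|) -> f \in continuous_functional.
Proof.
move=> lf fM; apply/mem_set; split=> //.
pose fl := GRing.isLinear.Build R[i] A R[i]^o _ f lf.
pose F : {linear A -> R[i]^o} := HB.pack f fl.
apply: (@bounded_linear_continuous _ _ _ F); apply/linear_boundedP.
exists M%:C; split; first by apply/complex_realP; exists M.
by move=> r Mr x; rewrite (le_trans (fM x))// ler_wpM2r// ltW.
Qed.

Definition dual_norm (f : dual) : R :=
  sup [set normc (f x) | x in [set x : A | `|x| <= 1]].

Let normed_has_sup (f : dual) :
  has_sup [set normc (f x) | x in [set x : A | `|x| <= 1]].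
Proof.
split; first by exists (normc (f 0)), 0 => //=; rewrite normr0.
have [M M0 fM] := dual_bounded f; exists M => _ [x /= x1 <-].
rewrite -lecR (le_trans (fM x))// -[leRHS]mulr1 ler_wpM2l//.
by rewrite ler0c.
Qed.

Lemma dual_norm_ge0 (f : dual) : 0 <= dual_norm f.
Proof.
apply: (@le_trans _ _ (normc (f 0))).
  by rewrite -ler0c -[_%:C]/`|f 0|.
apply: sup_upper_bound; first exact: normed_has_sup.
by exists 0 => //=; rewrite normr0.
Qed.

Lemma dual_normP (f : dual) (x : A) : `|f x| <= (dual_norm f)%:C * `|x|.
Proof.
have [->|x0] := eqVneq x 0; first by rewrite linear0 !normr0 mulr0.
have nx0 : 0 < `|x| by rewrite normr_gt0.
rewrite -ler_pdivrMr// mulrC -[X in X * _]ger0_norm ?invr_ge0//.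
rewrite -normrM -[_ * _]/(_ *: f x) -linearZ.
rewrite [leLHS](_ : _ = (normc (f (`|x|^-1 *: x)))%:C)// lecR.
apply: sup_upper_bound; first exact: normed_has_sup.
exists (`|x|^-1 *: x) => //=.
by rewrite normrZ ger0_norm ?invr_ge0// mulVf ?gt_eqF.
Qed.

Lemma dual_norm_le (f : dual) (M : R) :
  (forall x : A, `|x| <= 1 -> `|f x| <= M%:C) -> dual_norm f <= M.
Proof.
move=> fM; apply: ge_sup; first exact: (normed_has_sup f).1.
by move=> _ [x /= x1 <-]; rewrite -lecR; exact: fM.
Qed.

Let dual_normD (f g : dual) :
  (dual_norm (f + g))%:C <= (dual_norm f)%:C + (dual_norm g)%:C.
Proof.
rewrite -rmorphD lecR; apply: dual_norm_le => x x1.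
rewrite (le_trans (ler_normD _ _))// rmorphD lerD//.
  by rewrite (le_trans (dual_normP _ _))// ler_piMr// ler0c dual_norm_ge0.
by rewrite (le_trans (dual_normP _ _))// ler_piMr// ler0c dual_norm_ge0.
Qed.

Let dual_normZ_le (l : R[i]) (f : dual) :
  dual_norm (l *: f) <= normc l * dual_norm f.
Proof.
apply: dual_norm_le => x x1; rewrite rmorphM/= -[(normc l)%:C]/`|l|.
rewrite [leLHS]normrM ler_wpM2l// (le_trans (dual_normP _ _))//.
by rewrite ler_piMr// ler0c dual_norm_ge0.
Qed.

Let dual_normZ (l : R[i]) (f : dual) :
  (dual_norm (l *: f))%:C = `|l| * (dual_norm f)%:C.
Proof.
rewrite -[`|l|]/(normc l)%:C -rmorphM/=; congr _%:C.
apply/eqP; rewrite eq_le dual_normZ_le /=.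
have [->|l0] := eqVneq l 0; first by rewrite normc0 mul0r dual_norm_ge0.
have := dual_normZ_le l^-1 (l *: f).
rewrite scalerA mulVf// scale1r normcV ler_pdivlMl//.
rewrite -ltcR; have : 0 < `|l| by rewrite normr_gt0.
exact.
Qed.

Let dual_norm0_eq0 (f : dual) : (dual_norm f)%:C = 0 -> f = 0.
Proof.
move=> f0; apply/val_inj/funext => x /=; apply/eqP.
by rewrite -normr_le0 (le_trans (dual_normP f x))// f0 mul0r.
Qed.

HB.instance Definition _ := @Lmodule_isNormed.Build R[i] dual
  (fun f => (dual_norm f)%:C) dual_normD dual_normZ dual_norm0_eq0.

End Dual.

Section Action.
Variables (R : realType) (A : banachAlgType R).
Implicit Types (a : A) (L : dual A).

Lemma lact_subproof a L :
  (fun x => L (x ** a)) \in @continuous_functional R A.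
Proof.
have [M M0 LM] := dual_bounded L.
apply: (bounded_functional (M := M * complex.Re `|a|)).
  by move=> c x y; rewrite bmulDl bmulZl linearP.
move=> x; rewrite (le_trans (LM _))// rmorphM/= RRe_real ?ger0_real//.
by rewrite -mulrA ler_wpM2l ?ler0c// mulrC ler_normbM.
Qed.

Lemma ract_subproof L a :
  (fun x => L (a ** x)) \in @continuous_functional R A.
Proof.
have [M M0 LM] := dual_bounded L.
apply: (bounded_functional (M := M * complex.Re `|a|)).
  by move=> c x y; rewrite bmulDr bmulZr linearP.
move=> x; rewrite (le_trans (LM _))// rmorphM/= RRe_real ?ger0_real//.
by rewrite -mulrA ler_wpM2l ?ler0c// ler_normbM.
Qed.

(* The dual as an A-bimodule: lact a L is a . L, and ract L a is L . a. *)
Definition lact a L : dual A := Dual (lact_subproof a L).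
Definition ract L a : dual A := Dual (ract_subproof L a).

Definition derivation (D : {linear A -> dual A}) : Prop :=
  forall a b, D (a ** b) = lact a (D b) + ract (D a) b.

Definition cyclic_derivation (D : {linear A -> dual A}) : Prop :=
  derivation D /\ forall a b, D a b + D b a = 0.

End Action.

Definition directed (I : Type) (le : I -> I -> Prop) : Prop :=
  [/\ inhabited I, forall i, le i i,
      forall i j k, le i j -> le j k -> le i k &
      forall i j, exists k, le i k /\ le j k].

(* Convergence of a net indexed by (I, le) is convergence along this filter. *)
Definition tails (I : Type) (le : I -> I -> Prop) : set_system I :=
  [set P | exists i, forall j, le i j -> P j].

Definition approx_inner (R : realType) (A : banachAlgType R)
    (D : {linear A -> dual A}) : Prop :=
  exists (I : Type) (le : I -> I -> Prop) (L : I -> dual A),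
    directed le /\
    forall a : A, lact a (L i) - ract (L i) a @[i --> tails le] --> D a.

Definition approx_cyclic_amenable (R : realType) (A : banachAlgType R) : Prop :=
  forall D : {linear A -> dual A}, cyclic_derivation D -> approx_inner D.

(* The pair (c, a) stands for c e + a.  A type of its own is needed because the
   library norms products with the maximum, which is not submultiplicative
   here. *)
Definition unitization (R : realType) (A : banachAlgType R) : Type :=
  (R[i]^o * A)%type.

Section Unitization.
Variables (R : realType) (A : banachAlgType R).
Notation A1 := (unitization A).

HB.instance Definition _ := GRing.Lmodule.copy A1 (R[i]^o * A)%type.

Definition unitization_norm (u : A1) : R[i] := `|u.1| + `|u.2|.

Let unitization_normD (u v : A1) :
  unitization_norm (u + v) <= unitization_norm u + unitization_norm v.
Proof. by rewrite /unitization_norm addrACA lerD// ler_normD. Qed.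

Let unitization_normZ (c : R[i]) (u : A1) :
  unitization_norm (c *: u) = `|c| * unitization_norm u.
Proof. by rewrite /unitization_norm mulrDr -!normrZ. Qed.

Let unitization_norm0_eq0 (u : A1) : unitization_norm u = 0 -> u = 0.
Proof.
case: u => c a /eqP; rewrite paddr_eq0//= !normr_eq0.
by move=> /andP[/eqP -> /eqP ->].
Qed.

HB.instance Definition _ := @Lmodule_isNormed.Build R[i] A1
  unitization_norm unitization_normD unitization_normZ unitization_norm0_eq0.

Lemma unitization_normE (u : A1) : `|u| = `|u.1| + `|u.2|.
Proof. by []. Qed.

Lemma unitization_complete (F : set_system A1) :
  ProperFilter F -> cauchy F -> cvg F.
Proof.
move=> FF /cauchyP Fc.
have F1 : cvg ((fun u : A1 => u.1) @ F : set_system R[i]^o).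
  apply: complex_complete; apply/cauchyP => e e0.
  have [z Fz] := Fc e e0.
  exists z.1; rewrite /fmap/=; apply: filterS Fz => w.
  rewrite -!ball_normE /=; apply: le_lt_trans.
  by rewrite unitization_normE lerDl.
have F2 : cvg ((fun u : A1 => u.2) @ F : set_system A).
  apply: cauchy_cvg; apply/cauchyP => e e0.
  have [z Fz] := Fc e e0.
  exists z.2; rewrite /fmap/=; apply: filterS Fz => w.
  rewrite -!ball_normE /=; apply: le_lt_trans.
  by rewrite unitization_normE lerDr.
apply/cvg_ex.
exists (lim ((fun u : A1 => u.1) @ F), lim ((fun u : A1 => u.2) @ F)).
apply/cvgrPdist_lt => e e0.
have e20 : 0 < e / 2 by rewrite divr_gt0.
have /cvgrPdist_lt/(_ _ e20) G1 := F1.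
have /cvgrPdist_lt/(_ _ e20) G2 := F2.
apply: filterS2 G1 G2 => u u1 u2.
by rewrite unitization_normE [ltRHS]splitr ltrD.
Qed.

HB.instance Definition _ := Uniform_isComplete.Build A1 unitization_complete.

Definition unitization_mul (u v : A1) : A1 :=
  (u.1 * v.1, u.1 *: v.2 + v.1 *: u.2 + u.2 ** v.2).

Lemma bmul0l (a : A) : 0 ** a = 0.
Proof. by rewrite -[X in X ** a](scale0r (0 : A)) bmulZl scale0r. Qed.

Lemma bmul0r (a : A) : a ** 0 = 0.
Proof. by rewrite -[X in a ** X](scale0r (0 : A)) bmulZr scale0r. Qed.

Let unitization_mulDl : left_distributive unitization_mul +%R.
Proof.
move=> [c a] [d b] [f x]; apply: injective_projections; rewrite /= ?mulrDl//.
rewrite scalerDl scalerDr bmulDl.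
by rewrite [in RHS]addrACA; congr (_ + _); rewrite addrACA.
Qed.

Let unitization_mulDr : right_distributive unitization_mul +%R.
Proof.
move=> [c a] [d b] [f x]; apply: injective_projections; rewrite /= ?mulrDr//.
rewrite scalerDl scalerDr bmulDr.
by rewrite [in RHS]addrACA; congr (_ + _); rewrite addrACA.
Qed.

Let unitization_mulZl (c : R[i]) (u v : A1) :
  unitization_mul (c *: u) v = c *: unitization_mul u v.
Proof.
case: u v => [d a] [f b]; apply: injective_projections; rewrite /= -?mulrA//.
by rewrite !scalerDr bmulZl !scalerA [f * c]mulrC.
Qed.

Let unitization_mulZr (c : R[i]) (u v : A1) :
  unitization_mul u (c *: v) = c *: unitization_mul u v.
Proof.
case: u v => [d a] [f b]; apply: injective_projections => /=.
  exact: mulrCA.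
by rewrite !scalerDr bmulZr !scalerA [d * c]mulrC.
Qed.

Let unitization_mulA : associative unitization_mul.
Proof.
move=> [c a] [d b] [f x]; apply: injective_projections; rewrite /= ?mulrA//.
rewrite !scalerDr !scalerA !bmulDl !bmulDr !bmulZl !bmulZr bmulA.
rewrite [f * c]mulrC [f * d]mulrC !addrA.
by rewrite [LHS](ACl (1*2*4*6*3*5*7))%AC.
Qed.

Let unitization_normM (u v : A1) : `|unitization_mul u v| <= `|u| * `|v|.
Proof.
case: u v => [c a] [d b]; rewrite !unitization_normE/= mulrDl !mulrDr.
rewrite normrM -[leRHS]addrA lerD2l (le_trans (ler_normD _ _))//.
rewrite addrA lerD ?ler_normbM// (le_trans (ler_normD _ _))//.
by rewrite !normrZ lerD2l mulrC.
Qed.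

HB.instance Definition _ := NormedModule_isBanachAlgebra.Build R A1
  unitization_mulA unitization_mulDl unitization_mulDr
  unitization_mulZl unitization_mulZr unitization_normM.

Lemma unitization_unital : unital A1.
Proof.
exists ((1, 0) : A1) => -[c a].
split; apply: injective_projections; rewrite /= ?mul1r ?mulr1//.
  by rewrite scale1r scaler0 bmul0l !addr0.
by rewrite scale1r scaler0 bmul0r add0r addr0.
Qed.

End Unitization.

(* Main.v *)
(** Both directions transport derivations along a map [T] between [A] and its
    unitization, namely the inclusion and the projection [c e + a |-> a].  The
    projection is not multiplicative, but it preserves commutators, and this is
    all that is needed to pull back approximate innerness along [T].  A cyclic
    derivation [D] of [A] extends by [D e = 0]; the derivation identity for the
    extension uses cyclicity when the test vector is [e].  Conversely every
    cyclic derivation of the unitization kills [e], hence by cyclicity takes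
    values vanishing at [e], so it is the extension of its restriction to
    [A]. *)
From HB Require Import structures.
From mathcomp Require Import all_boot all_order all_algebra.
From mathcomp Require Import complex.
Require Import Defs.
From mathcomp Require Import all_classical all_reals all_analysis.

Set Implicit Arguments.
Unset Strict Implicit.
Unset Printing Implicit Defensive.

Import Order.TTheory GRing.Theory Num.Theory.
Import numFieldNormedType.Exports.

Local Open Scope classical_set_scope.
Local Open Scope ring_scope.
Local Open Scope complex_scope.
Local Open Scope banach_scope.

Section Adjoint.
Variables (R : realType) (A B : normedModType R[i]) (T : {linear A -> B}).
Hypothesis T_contract : forall x, `|T x| <= `|x|.

Lemma adjoint_subproof (f : dual B) :
  (fun x => f (T x)) \in @continuous_functional R A.
Proof.
have [M M0 fM] := dual_bounded f.
apply: (bounded_functional (M := M)) => [c x y|x]; first by rewrite !linearP.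
by rewrite (le_trans (fM _))// ler_wpM2l// ler0c.
Qed.

Definition adjoint (f : dual B) : dual A := Dual (adjoint_subproof f).

Lemma adjoint_linear : linear adjoint.
Proof. by move=> c f g; apply/val_inj/funext. Qed.

HB.instance Definition _ :=
  GRing.isLinear.Build R[i] (dual B) (dual A) _ adjoint adjoint_linear.

(** A contraction [T] maps the unit ball of [A] into that of [B]. The resulting norm continuity of
    [adjoint] is what lets it carry norm limits of nets. *)
Lemma adjoint_norm_le (f : dual B) : `|adjoint f| <= `|f|.
Proof.
rewrite [leLHS]/(_%:C) [leRHS]/(_%:C) lecR; apply: dual_norm_le => x x1.
rewrite (le_trans (dual_normP f (T x)))// ler_piMr ?ler0c ?dual_norm_ge0//.
exact: le_trans (T_contract x) x1.
Qed.

Lemma adjoint_continuous : continuous adjoint.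
Proof.
apply: bounded_linear_continuous; apply/linear_boundedP.
exists 1; split=> // r r1 f; rewrite (le_trans (adjoint_norm_le f))//.
by rewrite ler_peMl// ltW.
Qed.

End Adjoint.

(** The inner derivation given by [L] takes at [a] and [x] the value [L (x ** a - a ** x)], so it
    sees the product only through commutators. Hence the net [L i] composed with [T] works for
    [D]. *)
Lemma approx_inner_adjoint (R : realType) (A B : banachAlgType R)
    (T : {linear A -> B}) (T_contract : forall x, `|T x| <= `|x|)
    (T_comm : forall x y, T (x ** y - y ** x) = T x ** T y - T y ** T x)
    (D : {linear A -> dual A}) (E : {linear B -> dual B}) :
  (forall a x, D a x = E (T a) (T x)) -> approx_inner E -> approx_inner D.
Proof.
move=> DE [I [le [L [dir_le cvgL]]]].
exists I, le, (fun i => adjoint T_contract (L i)); split=> // a.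
have -> : D a = adjoint T_contract (E (T a)).
  by apply/val_inj/funext => x; exact: DE.
(* The inner derivation of [adjoint (L i)] at [a] is the adjoint of that of [L i] at [T a]. *)
rewrite [X in X @ _](_ : _ = adjoint T_contract \o
    (fun i => lact (T a) (L i) - ract (L i) (T a))).
  exact: cvg_comp (cvgL (T a)) (@adjoint_continuous _ _ _ _ T_contract _).
apply/funext => i; apply/val_inj/funext => x /=.
change (L i (T (x ** a)) - L i (T (a ** x)) =
  L i (T x ** T a) - L i (T a ** T x)).
by rewrite -!linearB T_comm.
Qed.

Section UnitizationMaps.
Variables (R : realType) (A : banachAlgType R).

Definition unitization_in (a : A) : unitization A := (0, a).
Definition unitization_snd (u : unitization A) : A := u.2.

Lemma unitization_in_linear : linear unitization_in.
Proof.
by move=> c a b; apply: injective_projections; rewrite //= scaler0 addr0.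
Qed.

HB.instance Definition _ := GRing.isLinear.Build R[i] A (unitization A) _
  unitization_in unitization_in_linear.

Lemma unitization_snd_linear : linear unitization_snd.
Proof. by []. Qed.

HB.instance Definition _ := GRing.isLinear.Build R[i] (unitization A) A _
  unitization_snd unitization_snd_linear.

Lemma unitization_in_contract (a : A) : `|unitization_in a| <= `|a|.
Proof. by rewrite unitization_normE normr0 add0r. Qed.

Lemma unitization_snd_contract (u : unitization A) :
  `|unitization_snd u| <= `|u|.
Proof. by rewrite unitization_normE lerDr. Qed.

Lemma unitization_sndM (u v : unitization A) :
  unitization_snd (u ** v) =
    u.1 *: unitization_snd v + v.1 *: unitization_snd u
    + unitization_snd u ** unitization_snd v.
Proof. by []. Qed.

Lemma unitization_inM (a b : A) :
  unitization_in (a ** b) = unitization_in a ** unitization_in b.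
Proof.
apply: injective_projections; first by rewrite /= mul0r.
by rewrite /= !scale0r !add0r.
Qed.

Lemma unitization_in_comm (a b : A) :
  unitization_in (a ** b - b ** a) =
  unitization_in a ** unitization_in b - unitization_in b ** unitization_in a.
Proof. by rewrite -!unitization_inM -linearB. Qed.

(** The cross terms [u.1 *: v.2 + v.1 *: u.2] of the product are symmetric in [u] and [v], so they
    cancel in the commutator. *)
Lemma unitization_snd_comm (u v : unitization A) :
  unitization_snd (u ** v - v ** u) =
  unitization_snd u ** unitization_snd v
  - unitization_snd v ** unitization_snd u.
Proof.
rewrite -[LHS]/(unitization_snd (u ** v) - unitization_snd (v ** u)).
by rewrite !unitization_sndM [v.1 *: _ + _]addrC [X in X - _]addrC addrKA.
Qed.

Definition unitization_one : unitization A := (1, 0).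

Lemma unitization_mul1l (u : unitization A) : unitization_one ** u = u.
Proof.
apply: injective_projections; rewrite /= ?mul1r//.
by rewrite scale1r scaler0 bmul0l !addr0.
Qed.

Lemma unitization_mul1r (u : unitization A) : u ** unitization_one = u.
Proof.
apply: injective_projections; rewrite /= ?mulr1//.
by rewrite scale1r scaler0 bmul0r add0r addr0.
Qed.

Lemma unitization_decomp (u : unitization A) :
  u = u.1 *: unitization_one + unitization_in (unitization_snd u).
Proof.
apply: injective_projections => /=; last by rewrite scaler0 add0r.
by rewrite addr0 [RHS]mulr1.
Qed.

End UnitizationMaps.

(** Testing against [x] moves both module actions into the argument, leaving an identity between
    scalars. *)
Lemma derivationE (R : realType) (A : banachAlgType R)
    (D : {linear A -> dual A}) :
  derivation D <-> forall a b x, D (a ** b) x = D b (x ** a) + D a (b ** x).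
Proof.
split=> [dD a b x|dD a b]; first by rewrite dD.
by apply/val_inj/funext => x; exact: dD.
Qed.

Section Extension.
Variables (R : realType) (A : banachAlgType R) (D : {linear A -> dual A}).

Definition extension : {linear unitization A -> dual (unitization A)} :=
  adjoint (@unitization_snd_contract R A) \o D \o @unitization_snd R A.

Lemma cyclic_derivation_extension :
  cyclic_derivation D -> cyclic_derivation extension.
Proof.
move=> [/derivationE dD cD]; split; last by move=> u v; exact: cD.
apply/derivationE => u v w.
change (D (unitization_snd (u ** v)) (unitization_snd w) =
  D (unitization_snd v) (unitization_snd (w ** u)) +
  D (unitization_snd u) (unitization_snd (v ** w))).
rewrite !unitization_sndM.
case: u v w => [c a] [d b] [f x]; rewrite /unitization_snd/=.
rewrite !linearD !linearZ /=.
change (c * D b x + d * D a x + D (a ** b) x =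
  f * D b a + c * D b x + D b (x ** a) +
  (d * D a x + f * D a b + D a (b ** x))).
(* The scalar part [f] of the test vector contributes [f * D b a + f * D a b], which cyclicity
   annihilates. The other terms match by the derivation identity on [A]. *)
have /eqP := cD b a; rewrite addr_eq0 => /eqP ->; rewrite dD mulrN.
by rewrite [RHS](AC (3*3) ((1*5)*((2*4)*(3*6))))%AC/= addNr add0r.
Qed.

End Extension.

Section Restriction.
Variables (R : realType) (A : banachAlgType R).
Variable D : {linear unitization A -> dual (unitization A)}.

Definition restriction : {linear A -> dual A} :=
  adjoint (@unitization_in_contract R A) \o D \o @unitization_in R A.

Lemma restrictionE (a x : A) :
  restriction a x = D (unitization_in a) (unitization_in x).
Proof. by []. Qed.

Lemma cyclic_derivation_restriction :
  cyclic_derivation D -> cyclic_derivation restriction.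
Proof.
move=> [/derivationE dD cD]; split; last by move=> a b; exact: cD.
by apply/derivationE => a b x; rewrite !restrictionE !unitization_inM dD.
Qed.

(** As [e ** e = e] and [e] acts trivially on both sides, the derivation identity at [e] reads
    [D e = D e + D e]. *)
Lemma derivation_one : derivation D -> D (unitization_one A) = 0.
Proof.
move=> /derivationE dD; apply/val_inj/funext => x.
have := dD (unitization_one A) (unitization_one A) x.
rewrite unitization_mul1r !unitization_mul1l unitization_mul1r => /eqP.
by rewrite eq_sym -subr_eq0 addrK => /eqP.
Qed.

(** This is the relation between two derivations that [approx_inner_adjoint] requires when [T] is
    the projection. It holds because the [e] component drops out in either slot. *)
Lemma cyclic_derivation_unitizationE : cyclic_derivation D ->
  forall u v, D u v = restriction (unitization_snd u) (unitization_snd v).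
Proof.
move=> [dD cD] u v; rewrite restrictionE.
have D1 := derivation_one dD.
have De w : D w (unitization_one A) = 0.
  by have := cD w (unitization_one A); rewrite D1 addr0.
have -> : D u = D (unitization_in (unitization_snd u)).
  by rewrite {1}(unitization_decomp u) linearD linearZ /= D1 scaler0 add0r.
by rewrite {1}(unitization_decomp v) linearD linearZ /= De scaler0 add0r.
Qed.

End Restriction.

Theorem proposition4p1 (R : realType) (A : banachAlgType R) (hA : ~ unital A) :
  approx_cyclic_amenable A <-> approx_cyclic_amenable (unitization A).
Proof.
split=> amen D cD.
- apply: (approx_inner_adjoint (@unitization_snd_contract R A)
    (@unitization_snd_comm R A) (cyclic_derivation_unitizationE cD)).
  exact/amen/cyclic_derivation_restriction.
(* Projecting after including is the identity, so [extension D] restricts to [D] by computation. *)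
- apply: (approx_inner_adjoint (@unitization_in_contract R A)
    (@unitization_in_comm R A) (E := extension D)) => //.
  exact/amen/cyclic_derivation_extension.
Qed.
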